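(* Let $\kappa$ be a strongly inaccessible cardinal. If $\binom{\kappa^+}{\kappa}\rightarrow\binom{2}{\kappa}_{<\kappa}$, then $\binom{\kappa^+}{\kappa}\rightarrow\binom{\gamma}{\kappa}_{<\kappa}$ for every ordinal $\gamma<\kappa$.
   Context: For ordinals $\alpha,\beta,\gamma,\delta$ and a cardinal $\chi$, $\binom{\alpha}{\beta}\rightarrow\binom{\gamma}{\delta}_\chi$ means: for every coloring $c:\alpha\times\beta\rightarrow\chi$ there are $A\subseteq\alpha$, $B\subseteq\beta$ and $i\in\chi$ such that $\mathrm{otp}(A)=\gamma$, $\mathrm{otp}(B)=\delta$ and $c$ is constantly $i$ on $A\times B$. The relation $\binom{\alpha}{\beta}\rightarrow\binom{\gamma}{\delta}_{<\kappa}$ means that $\binom{\alpha}{\beta}\rightarrow\binom{\gamma}{\delta}_{\chi}$ holds for every cardinal $\chi<\kappa$. *)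

(* Defs.v *)
From mathcomp Require Import all_boot.
From mathcomp Require Import boolp classical_sets functions cardinality.
From mathcomp Require wochoice.

Set Implicit Arguments.
Unset Strict Implicit.
Unset Printing Implicit Defensive.

Local Open Scope classical_set_scope.
Local Open Scope card_scope.

(* An ordinal is represented by a well-ordered type, and equality of ordinals
   by [ord_eq], i.e., by order isomorphism. *)
Record ordinalType := OrdinalType {
  carrier :> Type ;
  wle : rel carrier ;
  wle_wo : wochoice.well_order wle }.

Definition wlt (a : ordinalType) (x y : a) : bool := ~~ wle y x.

Definition init_seg (a : ordinalType) (x : a) : set a := [set y | wlt y x].

(* The subset A of a has order type g: a map f as below is injective, because
   [wle] is antisymmetric, so it is an isomorphism from g onto A. *)
Definition has_otp (a : ordinalType) (A : set a) (g : ordinalType) : Prop :=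
  exists f : g -> a, {mono f : x y / wle x y >-> wle x y} /\ range f = A.

Definition ord_eq (a b : ordinalType) : Prop := has_otp [set: b] a.

Definition ord_lt (a b : ordinalType) : Prop := exists x : b, has_otp (init_seg x) a.

Definition ord_le (a b : ordinalType) : Prop := ord_lt a b \/ ord_eq a b.

Lemma leq_well_order n :
  wochoice.well_order (fun i j : 'I_n => (i <= j)%N).
Proof.
apply: wochoice.antisymmetric_well_order.
  by move=> i j /anti_leq/val_inj.
move=> P [i0 Pi0]; case: (@arg_minnP _ i0 (mem P) val Pi0) => i Pi min_i.
by exists i; split=> // j; apply: min_i.
Qed.

Definition ord_nat (n : nat) : ordinalType := OrdinalType (@leq_well_order n).

Definition card_lt T U (A : set T) (B : set U) : Prop :=
  A #<= B /\ ~ (B #<= A).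

(* Cardinals are initial ordinals; finite ones are included. *)
Definition is_cardinal (a : ordinalType) : Prop :=
  forall x : a, card_lt (init_seg x) [set: a].

Definition is_succ_cardinal (k kp : ordinalType) : Prop :=
  [/\ is_cardinal kp, ord_lt k kp &
      forall l : ordinalType, is_cardinal l -> ord_lt k l -> ord_le kp l].

Definition cofinal (a : ordinalType) (A : set a) : Prop :=
  forall x : a, exists2 y : a, A y & wle x y.

Definition is_cofinality (a d : ordinalType) : Prop :=
  (exists2 A : set a, cofinal A & has_otp A d) /\
  (forall (A : set a) (e : ordinalType), cofinal A -> has_otp A e -> ord_le d e).

Definition is_regular (k : ordinalType) : Prop :=
  [/\ is_cardinal k, infinite_set [set: k] & is_cofinality k k].

Definition is_strong_limit (k : ordinalType) : Prop :=
  forall l : ordinalType, is_cardinal l -> ord_lt l k ->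
    card_lt [set: l -> bool] [set: k].

Definition strongly_inaccessible (k : ordinalType) : Prop :=
  [/\ ~ countable [set: k], is_regular k & is_strong_limit k].

(* (a, b) -> (g, d)_x *)
Definition polarized (a b g d x : ordinalType) : Prop :=
  forall c : a * b -> x, exists (A : set a) (B : set b) (i : x),
    [/\ has_otp A g, has_otp B d &
        forall p : a * b, (A `*` B) p -> c p = i].

(* (a, b) -> (g, d)_{<k} *)
Definition polarized_lt (a b g d k : ordinalType) : Prop :=
  forall x : ordinalType, is_cardinal x -> ord_lt x k -> polarized a b g d x.

(* Main.v *)
(** Fix a colouring [c] without homogeneous sets of type [gamma] times [kappa],
    and for every [a < kappa^+] an injection [e a] of [a] into [kappa], with
    [E a xi] the set of [eta < a] such that [e a eta < e a xi].  At [b < kappa]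
    join [a] to those [xi < a] for which [E a xi] contains no set of type
    [gamma] on which [c (-, b)] is constant.  As [E a xi] has fewer than
    [kappa] subsets, any two points are joined at all large [b].  On the other
    hand [E a xi] embeds in [Z = chi * gamma] whenever [a] is joined to [xi] at
    [b], so all proper [e a]-initial segments of the set of earlier neighbours
    of [a] embed in [Z] and the whole set embeds in [2 ^ Z].  Hence a greedy
    colouring [d (-, b)] of this graph needs at most [2 ^ 2 ^ Z < kappa]
    colours.  By hypothesis [d] is constant on a product of a pair with an
    unbounded set, which is impossible. *)
Require Import Defs.
From mathcomp Require Import all_boot.
From mathcomp Require Import boolp classical_sets functions cardinality.
From mathcomp Require wochoice.

Set Implicit Arguments.
Unset Strict Implicit.
Unset Printing Implicit Defensive.

Local Open Scope classical_set_scope.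
Local Open Scope card_scope.

(** * Well-orders: induction and recursion *)

Section WellOrder.
Context {a : ordinalType}.
Implicit Types (x y z : a) (S : set a).

Lemma wle_min S : S !=set0 -> exists2 z, S z & forall y, S y -> wle z y.
Proof.
move=> [x Sx]; have [|z [[]]] := @wle_wo a [pred y | `[< S y >]].
  by exists x; apply/asboolP.
move=> /asboolP Sz zmin _; exists z => // y Sy.
exact/zmin/asboolP.
Qed.

Lemma wle_refl x : wle x x.
Proof. by have [|z -> ->] := @wle_min [set x]; first by exists x. Qed.

Lemma wle_total x y : wle x y || wle y x.
Proof.
have [|z [->|->] zmin] := @wle_min [set x; y]; first by exists x; left.
- by rewrite zmin //; right.
- by rewrite orbC zmin //; left.
Qed.

(** Both points are least in the pair, and [well_order] demands a unique least element. *)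
Lemma wle_anti x y : wle x y -> wle y x -> x = y.
Proof.
move=> xy yx; have [|z [_ uniq]] := @wle_wo a [pred z | `[< z = x \/ z = y >]].
  by exists x; apply/asboolP; left.
have zx : z = x.
  apply: uniq; split=> [|w /asboolP[]->]; rewrite ?wle_refl //.
  by apply/asboolP; left.
rewrite -zx; apply: uniq; split=> [|w /asboolP[]->]; rewrite ?wle_refl //.
by apply/asboolP; right.
Qed.

Lemma wle_trans x y z : wle x y -> wle y z -> wle x z.
Proof.
move=> xy yz; have [|w Sw wmin] := @wle_min [set x; y; z].
  by exists x; left; left.
have [wx wy wz] : [/\ wle w x, wle w y & wle w z].
  by split; apply: wmin; [left; left|left; right|right].
case: Sw wx wy wz => [[->|->]|->] // => [yx _|_ zy _].
- by rewrite (wle_anti xy yx).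
- by rewrite -(wle_anti yz zy).
Qed.

Lemma wltW x y : wlt x y -> wle x y.
Proof. by move=> /negPf nyx; have := wle_total x y; rewrite nyx orbF. Qed.

Lemma wle_lt_trans x y z : wle x y -> wlt y z -> wlt x z.
Proof. by move=> xy; apply: contra => /wle_trans; apply. Qed.

Lemma wlt_le_trans x y z : wlt x y -> wle y z -> wlt x z.
Proof. by move=> xy yz; apply: contra xy; apply: wle_trans. Qed.

Lemma wlt_trans x y z : wlt x y -> wlt y z -> wlt x z.
Proof. by move=> /wltW; apply: wle_lt_trans. Qed.

Lemma wleNgt x y : wle x y = ~~ wlt y x.
Proof. by rewrite /wlt negbK. Qed.

Lemma wlt_total x y : x <> y -> wlt x y \/ wlt y x.
Proof.
move=> xy; case: (boolP (wlt x y)) => [|nxy]; [by left|right].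
apply/negP => lxy; apply: xy; apply: wle_anti => //.
by rewrite wleNgt.
Qed.

Lemma wlt_ind (P : a -> Prop) :
  (forall x, (forall y, wlt y x -> P y) -> P x) -> forall x, P x.
Proof.
move=> IH x; apply: contrapT => nPx.
have [|z nPz zmin] := @wle_min [set y | ~ P y]; first by exists x.
by apply: nPz; apply: IH => y; apply: contraPP => /zmin zy; rewrite /wlt zy.
Qed.

Lemma wlt_wf : well_founded (fun x y => wlt x y : Prop).
Proof. by apply: wlt_ind => x IH; constructor. Qed.

(* [Q x f] is a constraint on the value at [x], given the values [f] takes
   below [x]. *)
Lemma wlt_rec Z (z0 : Z) (Q : a -> (a -> Z) -> Z -> Prop) :
    (forall x f, exists v, Q x f v) ->
    (forall x f g v, (forall y, wlt y x -> f y = g y) -> Q x f v -> Q x g v) ->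
  exists f, forall x, Q x f (f x).
Proof.
move=> exQ locQ.
have [G GP] := choice (fun xf : a * (a -> Z) => exQ xf.1 xf.2).
(* [ext] gives a function known only below [x] the junk value [z0] elsewhere; [locQ] makes the junk
   harmless. *)
pose ext x (h : forall y, wlt y x -> Z) y :=
  if pselect (wlt y x) is left yx then h y yx else z0.
pose f := Fix wlt_wf (fun=> Z) (fun x h => G (x, ext x h)).
have fE x : f x = G (x, ext x (fun y _ => f y)).
  rewrite /f Fix_eq // => {}x h h' hh'; congr (G (x, _)).
  by apply: funext => y; rewrite /ext; case: pselect.
exists f => x; rewrite fE; apply: locQ (GP (x, _)) => y yx /=.
by rewrite /ext; case: pselect.
Qed.

End WellOrder.

Lemma mono_wle_inj (a b : ordinalType) (f : a -> b) :
  {mono f : x y / wle x y} -> injective f.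
Proof.
by move=> fmono x y fxy; apply: wle_anti; rewrite -fmono fxy wle_refl.
Qed.

(** * Comparison of cardinalities *)

Section CardLe.
Context {T U : Type}.
Implicit Types (A : set T) (B : set U).

Lemma card_leI A B (f : T -> U) :
  set_fun A B f -> set_inj A f -> A #<= B.
Proof.
move=> fAB finj; suff [g] : $|{injfun A >-> B}| by apply: inj_card_le.
by apply/injfunPex; exists f.
Qed.

Lemma card_leTE B : [set: T] #<= B ->
  exists2 f : T -> U, forall x, B (f x) & injective f.
Proof.
move=> /card_leP[f]; exists (fun x => \val (f (SigSub (mem_setT x)))) => [x|x y].
  exact: set_valP.
by move=> /val_inj /(@inj _ _ _ f); rewrite !inE => /(_ I I) [].
Qed.

Lemma card_leE A B : U -> A #<= B ->
  exists2 f : T -> U, set_fun A B f & set_inj A f.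
Proof.
elim/Ppointed: U B => V B u; first by have := no u.
by move=> /pcard_leP/injfunPex.
Qed.

Lemma card_surj_le A B (f : T -> U) : (forall y, B y -> exists2 x, A x & f x = y) ->
  B #<= A.
Proof.
move=> surj_f; apply: card_le_trans (card_image_le f A).
by apply: subset_card_le => y /surj_f.
Qed.

End CardLe.

Lemma not_card_le_powerset T : ~ ([set: T -> bool] #<= [set: T]).
Proof.
move=> /card_leTE[f _ finj].
(* Cantor's diagonal set: the points that code a set omitting them. *)
pose D t := `[< exists2 X, f X = t & ~~ X t >].
have DP t : reflect (exists2 X, f X = t & ~~ X t) (D t) by apply: asboolP.
have nDD : ~~ D (f D).
  by apply/negP => DD; have [X /finj XD] := DP _ DD; rewrite XD DD.
by move: (nDD) => /DP; apply; exists D.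
Qed.

Lemma card_le_powerset T U :
  [set: T] #<= [set: U] -> [set: T -> bool] #<= [set: U -> bool].
Proof.
move=> /card_leTE[f _ finj].
apply: (@card_leI _ _ _ _ (fun (X : T -> bool) u =>
  `[< exists2 t, f t = u & X t >])) => //.
move=> X Y _ _ XY; apply: funext => t.
have imE (Z : T -> bool) : `[< exists2 t', f t' = f t & Z t' >] = Z t.
  by apply/asboolP/idP => [[t' /finj->]|Zt] //; exists t.
by rewrite -!imE; have /(congr1 (fun h => h (f t))) := XY.
Qed.

Section CardLt.
Context {T U V : Type}.
Implicit Types (A : set T) (B : set U) (C : set V).

Lemma card_le_lt_trans A B C : A #<= B -> card_lt B C -> card_lt A C.
Proof.
move=> AB [BC nCB]; split; first exact: card_le_trans BC.
by move=> CA; apply/nCB/card_le_trans/AB.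
Qed.

End CardLt.

Lemma card_eq_leW T U (A : set T) (B : set U) : A #= B -> A #<= B.
Proof. by rewrite card_eq_le => /andP[]. Qed.

Lemma card_eq_ge T U (A : set T) (B : set U) : A #= B -> B #<= A.
Proof. by rewrite card_eq_le => /andP[]. Qed.

Lemma has_otp_card (a g : ordinalType) (A : set a) :
  has_otp A g -> [set: g] #= A.
Proof.
move=> [f [fmono <-]]; rewrite card_eq_sym; apply: inj_card_eq.
by move=> x y _ _; apply: mono_wle_inj.
Qed.

Lemma ord_le_card (a b : ordinalType) : ord_le a b -> [set: a] #<= [set: b].
Proof.
move=> [[x /has_otp_card/card_eq_leW/card_le_trans]|/has_otp_card/card_eq_leW//].
by apply; apply: card_leT.
Qed.

Lemma ord_lt_card (a k : ordinalType) :
  is_cardinal k -> ord_lt a k -> card_lt [set: a] [set: k].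
Proof. by move=> kc [x /has_otp_card/card_eq_leW/card_le_lt_trans]; apply. Qed.

(** * Comparison of well-orders, and cardinals as initial ordinals *)

Section SubOrdinal.
Context {a : ordinalType} (S : set a).

Lemma sub_wle_wo : wochoice.well_order (fun x y : S => wle (\val x) (\val y)).
Proof.
apply: wochoice.antisymmetric_well_order.
  by move=> x y /andP[xy yx]; apply/val_inj/wle_anti.
move=> P [x Px].
have [|y [z Pz <-] zmin] := @wle_min _ [set \val y | y in [set y | y \in P]].
  by exists (\val x), x.
by exists z; split=> // w Pw; apply: zmin; exists w.
Qed.

Definition sub_ord := OrdinalType sub_wle_wo.

Lemma has_otp_sub_ord : has_otp S sub_ord.
Proof.
exists (fun x : S => \val x); split=> //.
apply/seteqP; split=> [_ [x _ <-]|x Sx]; first exact: set_valP.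
by exists (SigSub (mem_set Sx)).
Qed.

End SubOrdinal.

Lemma wo_compare (a g : ordinalType) (S : set a) :
  (exists2 f : g -> a, {mono f : x y / wle x y} &
     (forall x, S (f x)) /\ (forall x s, S s -> wlt s (f x) -> range f s)) \/
  (exists x : g, S #= init_seg x).
Proof.
pose Q x (f : g -> option a) o :=
  if o is Some s then
    [/\ S s, forall y, wlt y x -> f y <> Some s &
        forall s', S s' -> wlt s' s -> exists2 y, wlt y x & f y = Some s']
  else forall s, S s -> exists2 y, wlt y x & f y = Some s.
have [||F FQ] := @wlt_rec g _ None Q.
- move=> x f; set D := S `\` [set s | exists2 y, wlt y x & f y = Some s].
  have [/wle_min[s [Ss ns] smin]|D0] := pselect (D !=set0); last first.
    by exists None => s Ss; apply: contrapT => ns; apply: D0; exists s.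
  exists (Some s); split=> //.
    by move=> y yx fy; apply: ns; exists y.
  move=> s' Ss' s's; apply: contrapT => ns'.
  by move: s's; rewrite /wlt smin.
- move=> x f h [s|] fh /=.
    move=> [Ss fs mins]; split=> // [y yx|s' Ss' /(mins _ Ss')[y yx]].
      by rewrite -fh //; apply: fs.
    by rewrite fh //; exists y.
  by move=> fs s /fs[y yx]; rewrite fh //; exists y.
have [|/existsNP[x1 /contrapT]] := pselect (forall x, F x <> None).
  move=> FN; left.
  have /choice[f fF] : forall x, exists s, F x = Some s.
    by move=> x; case: (F x) (FN x) => // s _; exists s.
  have fx_lt x y : wlt x y -> wlt (f x) (f y).
    move=> xy; have := FQ y; rewrite fF => -[Sy fy _].
    have [Exy|//|fyx] := @wlt_total _ (f x) (f y); first last.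
      have := FQ x; rewrite fF => -[_ _ /(_ _ Sy fyx)[z zx]].
      by move=> /(fy _ (wlt_trans zx xy)).
    by case: (fy _ xy); rewrite fF Exy.
  exists f.
    move=> x y; apply/idP/idP.
      by rewrite !wleNgt; apply: contra; apply: fx_lt.
    have [->|/wlt_total[xy _|xy]] := pselect (x = y); first by rewrite !wle_refl.
      exact/wltW/fx_lt.
    by rewrite wleNgt xy.
  split=> [x|x s Ss sfx]; first by have := FQ x; rewrite fF => -[].
  have := FQ x; rewrite fF => -[_ _ /(_ _ Ss sfx)[y _]].
  by rewrite fF => -[<-]; exists y.
move=> Fx1; right.
have [|x Fx xmin] := @wle_min _ [set x | F x = None]; first by exists x1.
exists x; have := FQ x; rewrite Fx => Ssurj.
(* One injection sends a point of [S] to a stage that picked it; the other is [F] itself below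
   [x]. *)
apply: Cantor_Bernstein.
  have /choice[h hF] : forall s, exists y, S s -> wlt y x /\ F y = Some s.
    move=> s; have [/Ssurj[y yx ys]|nSs] := pselect (S s); last by exists x.
    by exists y.
  apply: (@card_leI _ _ _ _ h) => [s /hF[]//|s s'].
  by rewrite !inE => /hF[_ hs] /hF[_ hs'] ss'; move: hs'; rewrite -ss' hs => -[].
apply: card_le_trans (card_eq_leW card_some).
have FS y : wlt y x -> exists2 s, F y = Some s & S s.
  move=> yx; have := FQ y; case Fy : (F y) => [s|]; first by case; exists s.
  by move: yx; rewrite /wlt xmin.
have Fneq y z : wlt z x -> wlt y z -> F y <> F z.
  move=> /FS[s zs _] yz ys; have := FQ z; rewrite zs => -[_ /(_ _ yz)].
  by rewrite ys.
apply: (@card_leI _ _ _ _ F) => [y /FS[s -> Ss]|y z]; first by exists s.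
rewrite !inE => yx zx Fyz; apply: contrapT => /wlt_total[yz|zy].
  exact: Fneq zx yz Fyz.
exact: Fneq yx zy (esym Fyz).
Qed.

(** A copy of [g] that is an initial segment of [S] is either all of [S] or lies below a point of
    [S], and the latter is forbidden. *)
Lemma card_le_of_init_seg (a g : ordinalType) (S : set a) :
    (forall s, S s -> ~ ([set: g] #<= S `&` init_seg s)) ->
  S #<= [set: g].
Proof.
move=> small; have [[f fmono [fS finit]]|[x /card_eq_leW/card_le_trans]] :=
  wo_compare g S; last by apply; apply: card_leT.
have [sub|/existsNP[s /not_implyP[Ss sf]]] := pselect (forall s, S s -> range f s).
  by apply: card_le_trans (card_image_le f _); apply: subset_card_le.
case: (small s Ss); apply: (@card_leI _ _ _ _ f) => [x _|x y _ _]; last first.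
  exact: mono_wle_inj.
split=> //; have [fxs|//|sfx] := @wlt_total _ (f x) s; last first.
  by case: sf; apply: finit sfx.
by case: sf; exists x.
Qed.

Lemma ord_lt_of_card (k l : ordinalType) :
  ~ ([set: l] #<= [set: k]) -> ord_lt k l.
Proof.
move=> nlk; have [[f fmono [_ finit]]|[x /card_eq_leW/card_le_trans lx]] :=
  wo_compare k [set: l]; last by case: nlk; apply: lx; apply: card_leT.
have [sub|/existsNP[s sf]] := pselect (forall s, range f s).
  case: nlk; apply: card_le_trans (card_image_le f _).
  by apply: subset_card_le => s _.
(* The range of [f] is an initial segment, so it consists of the points below the least missing
   one. *)
have [|w nw wmin] := @wle_min _ [set s | ~ range f s]; first by exists s.
exists w, f; split=> //; apply/seteqP; split=> [_ [x _ <-]|y yw].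
  have [fxw|//|wfx] := @wlt_total _ (f x) w; last by case: nw; apply: finit wfx.
  by case: nw; exists x.
by apply: contrapT => /wmin; apply/negP.
Qed.

(** The shortest initial segment of [k] equipotent with [A] serves; its minimality makes it an
    initial ordinal. *)
Lemma card_lt_cardinal (k : ordinalType) T (A : set T) :
    card_lt A [set: k] ->
  exists l, [/\ is_cardinal l, ord_lt l k & [set: l] #= A].
Proof.
move=> [Ak nkA]; have [[k0]|nk] := pselect (inhabited k); last first.
  case: nkA; suff -> : [set: k] = set0 by [].
  by apply/seteqP; split=> // x _; apply: nk; constructor.
have [f _ finj] := card_leE k0 Ak.
have SA : f @` A #= A by apply: inj_card_eq.
have [[h hmono [hS _]]|[x1 Sx1]] := wo_compare k (f @` A).
  case: nkA; apply: card_le_trans (card_eq_leW SA).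
  by apply: (@card_leI _ _ _ _ h) => // x y _ _; apply: mono_wle_inj.
have [|x /= Sx xmin] := @wle_min k [set x | f @` A #= init_seg x].
  by exists x1.
have lx : [set: sub_ord (init_seg x)] #= init_seg x := card_setT _.
exists (sub_ord (init_seg x)); split.
- move=> y; split; first exact: card_leT.
  move=> /(card_le_trans (card_eq_ge lx)) xy.
  have yx : wlt (\val y) x := set_valP y.
  suff /xmin : f @` A #= init_seg (\val y) by apply/negP.
  apply: card_eq_trans Sx _; apply: Cantor_Bernstein.
    apply: card_le_trans xy _.
    by apply: (@card_leI _ _ _ _ (fun z => \val z)) => // z z' _ _ /val_inj.
  by apply: subset_card_le => z zy; apply: wlt_trans zy yx.
- by exists x; apply: has_otp_sub_ord.
- apply: card_eq_trans lx _; apply: card_eq_trans SA.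
  by rewrite card_eq_sym.
Qed.

(** Otherwise the cardinal of the segment exceeds [k], so it is at least [kp] by minimality, yet the
    segment is smaller than [kp]. *)
Lemma succ_cardinal_init_seg (k kp : ordinalType) : is_succ_cardinal k kp ->
  forall x : kp, init_seg x #<= [set: k].
Proof.
move=> [kpc _ kpmin] x; have [l [lc _ lx]] := card_lt_cardinal (kpc x).
apply: contrapT => nxk; have /(kpmin l lc)/ord_le_card kpl : ord_lt k l.
  apply: ord_lt_of_card => lk; apply: nxk.
  exact: card_le_trans (card_eq_ge lx) lk.
by case: (kpc x) => _; apply; apply: card_le_trans kpl (card_eq_leW lx).
Qed.

(** A cofinal image of [A] would have order type at least [k], hence at least [k] elements. *)
Lemma regular_bounded (k : ordinalType) T (A : set T) (f : T -> k) :
    is_regular k -> ~ ([set: k] #<= A) ->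
  exists b, forall t, A t -> wlt (f t) b.
Proof.
move=> [_ _ [_ kmin]] nkA.
have [/kmin/(_ (has_otp_sub_ord _))/ord_le_card kfA|] :=
  pselect (cofinal (f @` A)).
  case: nkA; apply: card_le_trans kfA _.
  exact: card_le_trans (card_eq_leW (card_setT _)) (card_image_le f A).
move=> /existsNP[b nb]; exists b => t At; apply/negP => bft.
by apply: nb; exists (f t) => //; exists t.
Qed.

(** * Sets smaller than an inaccessible cardinal *)

Section Inaccessible.
Context {k : ordinalType} (kin : strongly_inaccessible k).

Lemma card_lt_powerset T :
  card_lt [set: T] [set: k] -> card_lt [set: T -> bool] [set: k].
Proof.
case: kin => _ _ ksl /card_lt_cardinal[l [lc lk lT]].
apply: card_le_lt_trans (ksl l lc lk).
exact/card_le_powerset/card_eq_ge.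
Qed.

Lemma card_lt_common T U :
    card_lt [set: T] [set: k] -> card_lt [set: U] [set: k] ->
  exists2 M : Type, card_lt [set: M] [set: k] &
    [set: T] #<= [set: M] /\ [set: U] #<= [set: M].
Proof.
case: kin => _ [kc _ _] _ Tk Uk.
have [lT [_ [x /has_otp_card xT] TT]] := card_lt_cardinal Tk.
have [lU [_ [y /has_otp_card yU] UU]] := card_lt_cardinal Uk.
have {lT xT TT} Tx : [set: T] #<= init_seg x.
  exact: card_le_trans (card_eq_ge TT) (card_eq_leW xT).
have {lU yU UU} Uy : [set: U] #<= init_seg y.
  exact: card_le_trans (card_eq_ge UU) (card_eq_leW yU).
have [z [Tz Uz]] : exists z : k, [set: T] #<= init_seg z /\ [set: U] #<= init_seg z.
  have sub (u v : k) : wle u v -> init_seg u #<= init_seg v.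
    by move=> uv; apply: subset_card_le => w wu; apply: wlt_le_trans uv.
  have /orP[/sub xy|/sub yx] := wle_total x y.
    by exists y; split=> //; apply: card_le_trans xy.
  by exists x; split=> //; apply: card_le_trans yx.
exists (init_seg z).
  exact: card_le_lt_trans (card_eq_leW (card_setT _)) (kc z).
by split; [apply: card_le_trans Tz _|apply: card_le_trans Uz _];
  apply/card_eq_ge/card_setT.
Qed.

(** With [T] and [U] embedded in one small [M], a pair is coded by the family of [L t], the
    principal ultrafilter at [f t], and [R u], the complement of the one at [g u]. This lands in a
    threefold power set of [M], still below [k]. *)
Lemma card_lt_prod T U : card_lt [set: T] [set: k] -> card_lt [set: U] [set: k] ->
  card_lt [set: T * U] [set: k].
Proof.
move=> Tk Uk; have [M Mk [/card_leTE[f _ finj] /card_leTE[g _ ginj]]] :=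
  card_lt_common Tk Uk.
apply: card_le_lt_trans (card_lt_powerset (card_lt_powerset (card_lt_powerset Mk))).
pose L t (X : M -> bool) := X (f t); pose R u (X : M -> bool) := ~~ X (g u).
(* The full set belongs to every [L t] and to no [R u], so the code tells its two members apart. *)
have LR t u : L t <> R u by move=> /(congr1 (fun h => h xpredT)).
have Linj : injective L.
  move=> t t' LL; apply: finj; apply: esym.
  have : L t (fun x => `[< x = f t >]) by apply/asboolP.
  by rewrite LL => /asboolP.
have Rinj : injective R.
  move=> u u' RR; apply: ginj; apply: esym.
  have : ~~ R u (fun x => `[< x = g u >]) by rewrite negbK; apply/asboolP.
  by rewrite RR => /negPn/asboolP.
apply: (@card_leI _ _ _ _ (fun (p : T * U) (W : (M -> bool) -> bool) =>
  `[< W = L p.1 \/ W = R p.2 >])) => //.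
move=> [t u] [t' u'] _ _ /= E; congr pair.
  have /asboolP[/Linj//|/LR//] : `[< L t = L t' \/ L t = R u' >].
  have /(congr1 (fun h => h (L t))) /= <- := E.
  by apply/asboolP; left.
have /asboolP[/esym/LR//|/Rinj//] : `[< R u = L t' \/ R u = R u' >].
have /(congr1 (fun h => h (R u))) /= <- := E.
by apply/asboolP; right.
Qed.

(** If [k] does not embed in [B], then [B] is smaller than [k], hence bounded by regularity. *)
Lemma has_otp_of_unbounded (B : set k) :
    (forall b, exists2 x, B x & wle b x) ->
  exists2 B' : set k, B' `<=` B & has_otp B' k.
Proof.
case: kin => _ kreg _ Bub.
have [[f fmono [fB _]]|[x Bx]] := wo_compare k B.
  by exists (range f); [move=> _ [x _ <-]|exists f].
have nkB : ~ ([set: k] #<= B).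
  case: kreg => kc _ _ kB; case: (kc x) => _; apply.
  exact: card_le_trans kB (card_eq_leW Bx).
have [b Bb] := regular_bounded id kreg nkB.
by have [y /Bb] := Bub b; rewrite /wlt => /negP.
Qed.

(** * Sets on which a single column is constant *)

Section Homogeneous.
Context {kp g x : ordinalType} (c : kp * k -> x).
Hypothesis xk : card_lt [set: x] [set: k].

Definition homogeneous_at (A : set kp) (b : k) :=
  exists i, forall a, A a -> c (a, b) = i.

(** Each colour class of [E] contains no copy of [g], so it injects into [g]; a point is coded by
    its colour and its place in the class. *)
Lemma card_le_inhomogeneous (E : set kp) (b : k) :
    (forall A, A `<=` E -> has_otp A g -> ~ homogeneous_at A b) ->
  E #<= [set: x * g].
Proof.
move=> inhom.
have Ei i : E `&` [set a | c (a, b) = i] #<= [set: g].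
  have [[f fmono [fE _]]|[y /card_eq_leW/card_le_trans]] :=
    wo_compare g (E `&` [set a | c (a, b) = i]); last by apply; apply: card_leT.
  case: (inhom (range f)) => [_ [y _ <-]||]; first by case: (fE y).
    by exists f.
  by exists i => _ [y _ <-]; case: (fE y).
(* The total maps [h] below need a point of [g]; for empty [g] all classes are empty, and so is
   [E]. *)
have [[u]|ng] := pselect (inhabited g); last first.
  suff -> : E = set0 by [].
  apply/seteqP; split=> // a Ea; apply: ng.
  have [h _] :=
    card_leTE (card_le_trans (card_eq_leW (card_setT _)) (Ei (c (a, b)))).
  have Eca : (E `&` [set a' | c (a', b) = c (a, b)]) a by [].
  by move=> _; exists; apply: h (SigSub (mem_set Eca)).
have /choice[h hP] i : exists h : kp -> g,
    set_inj (E `&` [set a | c (a, b) = i]) h.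
  by have [h _ hinj] := card_leE u (Ei i); exists h.
apply: (@card_leI _ _ _ _ (fun a => (c (a, b), h (c (a, b)) a))) => // a a'.
rewrite !inE => Ea Ea' [caa' haa']; apply: (hP (c (a, b))); rewrite ?inE //.
by rewrite {2}caa'.
Qed.

Hypothesis nopol : forall A B (i : x), has_otp A g -> has_otp B k ->
  ~ forall p : kp * k, (A `*` B) p -> c p = i.

(** For each colour the good columns are bounded, since an unbounded set of them would contradict
    [nopol]; regularity bounds these fewer than [k] bounds. *)
Lemma homogeneous_bounded (A : set kp) :
  has_otp A g -> exists b, forall b', wle b b' -> ~ homogeneous_at A b'.
Proof.
move=> Ag; case: kin => _ kreg _.
have /choice[bi biP] (i : x) :
    exists b, forall b', wle b b' -> ~ forall a, A a -> c (a, b') = i.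
  apply: contrapT => /forallNP nb.
  have [|B BA /(@nopol _ _ i Ag)] :=
    @has_otp_of_unbounded [set b | forall a, A a -> c (a, b) = i].
    move=> b; have /existsNP[b' /not_implyP[bb' /contrapT cb']] := nb b.
    by exists b'.
  by apply=> -[a b] [/= Aa /BA]; apply.
have [_ nkx] := xk.
have [b bP] := regular_bounded bi kreg nkx.
exists b => b' bb' [i ci]; apply: biP ci.
exact: wle_trans (wltW (bP i I)) bb'.
Qed.

Lemma homogeneous_subset_bounded (E : set kp) :
    card_lt E [set: k] ->
  exists b, forall b', wle b b' ->
    forall A, A `<=` E -> has_otp A g -> ~ homogeneous_at A b'.
Proof.
move=> Ek; case: kin => _ kreg _.
have /card_lt_powerset[_ nkE] := card_le_lt_trans (card_eq_leW (card_setT E)) Ek.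
(* Subsets of [E] are indexed by Boolean functions, of which there are fewer than [k], so that
   regularity applies to their bounds. *)
pose S (X : E -> bool) : set kp := [set \val t | t in [set t | X t]].
have /choice[bX bXP] (X : E -> bool) :
    exists b, forall b', wle b b' -> has_otp (S X) g -> ~ homogeneous_at (S X) b'.
  have [/homogeneous_bounded[b bP]|nS] := pselect (has_otp (S X) g).
    by exists b => b' /bP.
  have [b0] : inhabited k.
    apply: contrapT => nk; apply: nkE; suff -> : [set: k] = set0 by [].
    by apply/seteqP; split=> // y _; apply: nk.
  by exists b0.
have [b bP] := regular_bounded bX kreg nkE.
exists b => b' bb' A AE Ag.
have AS : A = S (fun t => `[< A (\val t) >]).
  apply/seteqP; split=> [a Aa|_ [t /asboolP At <-]//].
  by exists (SigSub (mem_set (AE a Aa))) => //; apply/asboolP.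
rewrite AS; apply: bXP; last by rewrite -AS.
exact: wle_trans (wltW (bP _ I)) bb'.
Qed.

End Homogeneous.

End Inaccessible.

(** * Greedy colouring, and the passage from pairs to type gamma *)

Lemma greedy_coloring (a : ordinalType) Y (P : a -> set a) :
    (forall u, P u #<= [set: Y]) ->
  exists d : a -> Y -> bool, forall u v, wlt v u -> P u v -> d v <> d u.
Proof.
move=> PY.
have [||d dP] := @wlt_rec a _ (fun=> true)
  (fun u (f : a -> Y -> bool) X => forall v, wlt v u -> P u v -> f v <> X).
(* If no colour were free, [f] would map [P u] onto the power set of [Y], against Cantor. *)
- move=> u f; apply: contrapT => /forallNP nX; apply: (@not_card_le_powerset Y).
  apply: card_le_trans (PY u); apply: (card_surj_le (f := f)) => X _.
  have /existsNP[v /not_implyP[vu /not_implyP[Pv /contrapT fv]]] := nX X.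
  by exists v.
- by move=> u f h X fh fX v vu Pv; rewrite -fh //; apply: fX.
by exists d.
Qed.

Theorem theorem2p2 (kappa kappa_plus : ordinalType)
  (hkappa : strongly_inaccessible kappa)
  (hplus : is_succ_cardinal kappa kappa_plus)
  (h2 : polarized_lt kappa_plus kappa (ord_nat 2) kappa kappa) :
  forall gamma : ordinalType, ord_lt gamma kappa ->
    polarized_lt kappa_plus kappa gamma kappa kappa.
Proof.
move=> g gk chi chic chik c.
case: (hkappa) => _ [kc kinf _] _.
have [k0 _] := infinite_setN0 kinf.
move: gk chik => /(ord_lt_card kc) gk /(ord_lt_card kc) chik.
apply: contrapT => ncAB.
have nopol A B (i : chi) : has_otp A g -> has_otp B kappa ->
    ~ forall p : kappa_plus * kappa, (A `*` B) p -> c p = i.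
  by move=> Ag Bk cAB; apply: ncAB; exists A, B, i.
have /choice[e einj] (a : kappa_plus) :
    exists e : kappa_plus -> kappa, set_inj (init_seg a) e.
  by have [e _ einj] := card_leE k0 (succ_cardinal_init_seg hplus a); exists e.
pose E a xi := [set eta | init_seg a eta /\ wlt (e a eta) (e a xi)].
pose P b a := [set xi | init_seg a xi /\
  forall A, A `<=` E a xi -> has_otp A g -> ~ homogeneous_at c A b].
have Zk := card_lt_prod hkappa chik gk; set Z := (_ * _)%type in Zk.
have Yk := card_lt_powerset hkappa Zk; set Y := Z -> bool in Yk.
(* [card_le_of_init_seg] compares with an ordinal, so [Y] is replaced by its cardinal [l]. *)
have [l [lc lk lY]] := card_lt_cardinal Yk.
have PY b a : P b a #<= [set: Y].
  have Pe : e a @` P b a #= P b a.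
    apply: inj_card_eq => u v; rewrite !inE => -[ua _] [va _].
    by apply: einj; rewrite inE.
  apply: card_le_trans (card_eq_ge Pe) _; apply: card_le_trans (card_eq_leW lY).
  (* A segment of the image below [e a xi] comes from [E a xi], which injects into [Z]; it cannot
     have as many elements as [Y], the power set of [Z]. *)
  apply: card_le_of_init_seg => _ [xi [xia inhom] <-] lE.
  apply: (@not_card_le_powerset Z).
  apply: card_le_trans (card_eq_ge lY) _; apply: card_le_trans lE _.
  apply: card_le_trans (card_le_inhomogeneous inhom).
  apply: (card_surj_le (f := e a)) => _ [[eta [etaa _] <-] etaxi].
  by exists eta.
have /choice[d dP] b := greedy_coloring (PY b).
(* The greedy colours are subsets of [Y]; [h] recodes them in a cardinal [m] below [kappa], as [h2]
   requires. *)
have [m [mc mk mY]] := card_lt_cardinal (card_lt_powerset hkappa Yk).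
have [h _ hinj] := card_leTE (card_eq_ge mY).
have [A [B [i [[f [fmono fA]] Bk di]]]] := h2 m mc mk (fun p => h (d p.2 p.1)).
pose xi := f ord0; pose a := f ord_max.
have xia : wlt xi a by rewrite /wlt fmono.
have [b0 b0P] : exists b0, forall b, wle b0 b -> P b a xi.
  have [|b0 b0P] := homogeneous_subset_bounded hkappa chik nopol (E := E a xi).
    (* [e a] maps [E a xi] injectively below [e a xi], so it is smaller than [kappa]. *)
    apply: card_le_lt_trans (kc (e a xi)).
    apply: (@card_leI _ _ _ _ (e a)) => [eta []//|u v].
    by rewrite !inE => -[ua _] [va _]; apply: einj; rewrite inE.
  by exists b0 => b /b0P.
have [b Bb b0b] : exists2 b, B b & wle b0 b.
  (* Otherwise [B], of size [kappa], would lie below [b0]. *)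
  apply: contrapT => nB; case: (kc b0) => _; apply.
  apply: card_le_trans (card_eq_leW (has_otp_card Bk)) _.
  apply: subset_card_le => b Bb; apply/negP => b0b.
  by apply: nB; exists b.
apply: (dP b a xi xia (b0P b b0b)); apply: hinj.
by rewrite (di (xi, b)) ?(di (a, b)) //; split=> //=;
  rewrite -fA; [exists ord_max|exists ord0].
Qed.
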